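(* Let $G$ be a distinguished group and let $A$ be a simple subgroup of $G$ of order $v$. Call a set $A.l$ ($l\in G$) special if $(A.l).(A.x)=A.(l.x)$ for every $x\in G$, and let $\Sigma$ be the union of all special sets $A.l$. Then either $G=\Sigma$ (that is, every $A.p$, $p\in G$, is special), or $G$ contains at least $v$ distinct special subgroups $A.l$.
   Context: A distributive group is a nonempty set $G$ with a binary operation $(a,b)\mapsto a.b$ on $G$ such that for all $a,b\in G$ each of the equations $a.x=b$ and $y.a=b$ has exactly one solution in $G$, and for all $a,b,c\in G$, $(a.b).c=(a.c).(b.c)$ and $c.(a.b)=(c.a).(c.b)$. A subgroup of $G$ is a nonempty subset which is itself a distributive group under the restricted operation; the order is the number of elements. A distributive group is simple if it has no proper subgroup of order greater than one. For subsets $X,Y\subseteq G$ and $p\in G$: $X.Y=\{x.y: x\in X,\,y\in Y\}$, $X.p=\{x.p: x\in X\}$, $p.X=\{p.x:x\in X\}$; if $X$ is a subgroup, so is $X.p$. A finite distributive group $G$ is called distinguished if for every subgroup $B$ of $G$ and every $p\in G$, the sets $B.(B.p)$ and $(B.p).B$ are subgroups of the same order as $B$; equivalently there are $t,\tau\in G$ with $B.(B.p)=B.t$ and $(B.p).B=B.(p.B)=B.\tau$. *)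

(* Defs.v *)
From mathcomp Require Import all_boot.

Set Implicit Arguments.
Unset Strict Implicit.
Unset Printing Implicit Defensive.

Section DistributiveGroups.

Variables (G : finType) (op : G -> G -> G).

(* [B] with the restriction of [op]; the group [G] itself is [B = [set: G]]. *)
Definition distributive_group (B : {set G}) : Prop :=
  [/\ B != set0,
      {in B &, forall a b, op a b \in B},
      {in B &, forall a b, exists! x, x \in B /\ op a x = b},
      {in B &, forall a b, exists! y, y \in B /\ op y a = b} &
      {in B & &, forall a b c,
         op (op a b) c = op (op a c) (op b c) /\
         op c (op a b) = op (op c a) (op c b)}].

Definition subgroup_of (B H : {set G}) : Prop :=
  B \subset H /\ distributive_group B.

Definition simple_group (H : {set G}) : Prop :=
  distributive_group H /\
  ~ (exists B : {set G}, [/\ subgroup_of B H, B \proper H & 1 < #|B|]).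

Definition prod_set (X Y : {set G}) : {set G} := [set op x y | x in X, y in Y].

Definition rtrans (X : {set G}) (p : G) : {set G} := [set op x p | x in X].

Definition distinguished : Prop :=
  distributive_group [set: G] /\
  (forall (B : {set G}) (p : G), subgroup_of B [set: G] ->
     [/\ subgroup_of (prod_set B (rtrans B p)) [set: G],
         #|prod_set B (rtrans B p)| = #|B|,
         subgroup_of (prod_set (rtrans B p) B) [set: G] &
         #|prod_set (rtrans B p) B| = #|B|]).

Definition special (A : {set G}) (l : G) : bool :=
  [forall x, prod_set (rtrans A l) (rtrans A x) == rtrans A (op l x)].

Definition special_sets (A : {set G}) : {set {set G}} :=
  [set rtrans A l | l in special A].

Definition special_union (A : {set G}) : {set G} :=
  \bigcup_(S in special_sets A) S.

End DistributiveGroups.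

(* Main.v *)
Require Import Defs.
From mathcomp Require Import all_boot.

(** Write <A, p> for the subgroup generated by A and p, and call p special when
    A.p is.

    The inclusion A.(p.x) <= (A.p).(A.x) always holds, so p fails to be special
    exactly when some x and some a, b in A put (a.p).(b.x) outside A.(p.x).

    Suppose that there are nonspecial elements, choose such a p with <A, p> as
    small as possible, then x, a, b as above, and put M = <A, p> n <A, x>.  Two
    facts govern this situation.

    - The mediality relation (a.b).(c.d) = (a.c).(b.d), as a condition on one
      of the four letters, cuts out a closed set, because translations are
      automorphisms.  Since a simple group is generated by any two distinct
      elements, the relation (a.p).(b.x) = (a.b).(p.x) therefore spreads from
      trivial instances to all a, b in A and all p in <A, x>
      ([medial_of_generated]).  Hence p does not lie in <A, x>, M is a
      proper subgroup of <A, p>, and by minimality every m in M is special.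

    - In a distinguished group, (A.p).(A.x) is contained in both translates
      <A, p>.(p.x) and <A, x>.(p.x), hence in M.(p.x) ([prod_in_meet]).

    The set C = (A.p).(b.x) is thus a copy of the simple group A inside M.(p.x),
    and M.(p.x) is covered by the subgroups (A.m).(p.x), m in M.  Such a
    subgroup is equal to A.(p.x) for m in A and disjoint from it otherwise.  As
    C meets A.(p.x), in (b.p).(b.x), without being contained in it, because of
    (a.p).(b.x), it is contained in no (A.m).(p.x), and by simplicity it meets
    each of them in at most one point.  So there are at least |A| distinct sets
    A.m with m in M ([many_translates]), all of them special. *)

Set Implicit Arguments.
Unset Strict Implicit.
Unset Printing Implicit Defensive.

(** * Closed subsets of a finite distributive group *)

Section DistributiveQuasigroup.

Variables (G : finType) (op : G -> G -> G).

Local Notation "x * y" := (op x y).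

Hypothesis opI : forall a, injective (op a).
Hypothesis opIr : forall c, injective (op^~ c).
Hypothesis opDr : forall a b c, (a * b) * c = (a * c) * (b * c).
Hypothesis opDl : forall a b c, c * (a * b) = (c * a) * (c * b).

Lemma op_idem a : a * a = a.
Proof. by apply: (@opIr (a * a)); rewrite /= [RHS]opDl. Qed.

Definition op_closed (B : {set G}) : bool :=
  [forall a in B, forall b in B, a * b \in B].

Lemma op_closedP (B : {set G}) :
  reflect {in B &, forall a b, a * b \in B} (op_closed B).
Proof.
apply: (iffP forall_inP) => [clB a b Ba Bb | clB a Ba].
  by have /forall_inP := clB a Ba; apply.
by apply/forall_inP=> b Bb; apply: clB.
Qed.

(** An injective translation of a finite closed set into itself is onto. *)
Lemma closed_ldiv (B : {set G}) a b :
  op_closed B -> a \in B -> b \in B -> exists2 x, x \in B & a * x = b.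
Proof.
move=> /op_closedP clB Ba Bb.
have sub : op a @: B \subset B.
  by apply/subsetP=> _ /imsetP[x Bx ->]; apply: clB.
have /eqP im : op a @: B == B by rewrite eqEcard sub card_imset //=; apply: opI.
by move: Bb; rewrite -{1}im => /imsetP[x Bx ->]; exists x.
Qed.

Lemma closed_rdiv (B : {set G}) a b :
  op_closed B -> a \in B -> b \in B -> exists2 y, y \in B & y * a = b.
Proof.
move=> /op_closedP clB Ba Bb.
have sub : op^~ a @: B \subset B.
  by apply/subsetP=> _ /imsetP[x Bx ->]; apply: clB.
have /eqP im : op^~ a @: B == B.
  by rewrite eqEcard sub card_imset //=; apply: opIr.
by move: Bb; rewrite -{1}im => /imsetP[y By ->]; exists y.
Qed.

Lemma closed_ldiv_mem (B : {set G}) a x :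
  op_closed B -> a \in B -> a * x \in B -> x \in B.
Proof. by move=> clB Ba Bax; have [y By /opI <-] := closed_ldiv clB Ba Bax. Qed.

Lemma closed_subgroup (B : {set G}) :
  B != set0 -> op_closed B -> subgroup_of op B [set: G].
Proof.
move=> B0 clB; split; first exact: subsetT.
split=> //; first exact/op_closedP.
- move=> a b Ba Bb; have [x Bx ax] := closed_ldiv clB Ba Bb.
  by exists x; split=> // x' [_ ax']; apply: (@opI a); rewrite ax ax'.
- move=> a b Ba Bb; have [y By ya] := closed_rdiv clB Ba Bb.
  by exists y; split=> // y' [_ ya']; apply: (@opIr a); rewrite /= ya ya'.
Qed.

Lemma rtrans_closed (B : {set G}) c : op_closed B -> op_closed (rtrans op B c).
Proof.
move=> /op_closedP clB; apply/op_closedP.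
move=> _ _ /imsetP[a Ba ->] /imsetP[b Bb ->].
by rewrite -opDr imset_f // clB.
Qed.

Lemma card_rtrans (B : {set G}) c : #|rtrans op B c| = #|B|.
Proof. by apply: card_imset; apply: opIr. Qed.

Lemma mem_rtrans (B : {set G}) a c : (a * c \in rtrans op B c) = (a \in B).
Proof. by apply: mem_imset; apply: opIr. Qed.

Definition generated (A : {set G}) (p : G) : {set G} :=
  \bigcap_(B : {set G} | op_closed B && (p |: A \subset B)) B.

Lemma generated_closed A p : op_closed (generated A p).
Proof.
apply/op_closedP=> a b /bigcapP Ha /bigcapP Hb; apply/bigcapP=> B HB.
by case/andP: (HB) => /op_closedP clB _; apply: clB; [apply: Ha|apply: Hb].
Qed.

Lemma generated_id A p : p \in generated A p.
Proof. by apply/bigcapP=> B /andP[_ /subsetP]; apply; apply: setU11. Qed.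

Lemma sub_generated (A : {set G}) p : A \subset generated A p.
Proof.
apply/bigcapsP=> B /andP[_]; apply: subset_trans; exact: subsetUr.
Qed.

Lemma generated_min (A B : {set G}) p :
  op_closed B -> A \subset B -> p \in B -> generated A p \subset B.
Proof.
move=> clB AB pB; apply: bigcap_inf.
by rewrite clB subUset sub1set pB.
Qed.

(** Translations are automorphisms, so both sides of the mediality relation are
    multiplicative in [b]. *)
Lemma closed_medial a c d :
  op_closed [set b | (a * b) * (c * d) == (a * c) * (b * d)].
Proof.
apply/op_closedP=> b b'; rewrite !inE => /eqP Hb /eqP Hb'.
by apply/eqP; rewrite (opDl b b' a) (opDr (a * b)) Hb Hb' (opDr b) [RHS]opDl.
Qed.

(** * Mediality around a simple subgroup *)

Section SimpleSubgroup.

Variable A : {set G}.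
Hypothesis clA : op_closed A.
Hypothesis simpleA :
  forall E : {set G}, op_closed E -> E \subset A -> 1 < #|E| -> E = A.

(** Any two distinct elements generate a simple group. *)
Lemma simple_sub_closed (E : {set G}) a b :
  op_closed E -> a \in A :&: E -> b \in A :&: E -> a != b -> A \subset E.
Proof.
move=> /op_closedP clE aAE bAE ab; apply/setIidPl; apply: simpleA.
- apply/op_closedP=> x y /setIP[Ax Ex] /setIP[Ay Ey].
  by rewrite inE (op_closedP _ clA) //= clE.
- exact: subsetIl.
- by apply/card_gt1P; exists a, b; split.
Qed.

(** The relation is closed in [p] and trivial for [p = x], so it suffices to
    treat [p] in [A].  There it is closed in [b] and trivial for [b = a] and for
    [b = p], and these two elements generate [A]. *)
Lemma medial_of_generated x p a b :
  p \in generated A x -> a \in A -> b \in A ->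
  (a * p) * (b * x) = (a * b) * (p * x).
Proof.
move=> px aA bA.
have mem3 q : q \in A -> (a * q) * (b * x) = (a * b) * (q * x).
  move=> qA; have [-> | naq] := eqVneq a q.
    by rewrite op_idem opDl.
  have /subsetP/(_ b bA) :
      A \subset [set c | (a * c) * (q * x) == (a * q) * (c * x)].
    apply: (simple_sub_closed (closed_medial a q x) _ _ naq).
      by rewrite !inE aA op_idem opDl /=.
    by rewrite !inE qA /=.
  by rewrite inE => /eqP.
have sub :
    generated A x \subset [set q | (a * q) * (b * x) == (a * b) * (q * x)].
  apply: generated_min; first exact: closed_medial.
    by apply/subsetP=> q /mem3 E; rewrite inE E.
  by rewrite inE op_idem -opDr.
by have /subsetP/(_ p px) := sub; rewrite inE => /eqP.
Qed.

(** Left distributivity gives the inclusion of A.(p.x) in (A.p).(A.x), so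
    only the opposite one can fail. *)
Lemma special_witness p :
  ~~ special op A p ->
  exists x a b, [/\ a \in A, b \in A &
    (a * p) * (b * x) \notin rtrans op A (p * x)].
Proof.
rewrite negb_forall => /existsP[x]; rewrite eqEsubset negb_and.
case/orP=> /subsetPn[z].
  case/imset2P=> _ _ /imsetP[a aA ->] /imsetP[b bA ->] -> nz.
  by exists x, a, b.
case/imsetP=> a aA -> /negP[].
by rewrite opDl; apply: imset2_f; apply: imset_f.
Qed.

(** * Translates in a distinguished group *)

Lemma generated_subgroup p : subgroup_of op (generated A p) [set: G].
Proof.
apply: closed_subgroup; last exact: generated_closed.
by apply/set0Pn; exists p; apply: generated_id.
Qed.

Hypothesis distL : forall (B : {set G}) p, subgroup_of op B [set: G] ->
  #|prod_set op B (rtrans op B p)| = #|B|.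
Hypothesis distR : forall (B : {set G}) p, subgroup_of op B [set: G] ->
  #|prod_set op (rtrans op B p) B| = #|B|.

(** Distributivity puts B.(h.x) inside B.(B.x), and being distinguished makes
    their cardinals equal; [rtrans_prodE] is the mirror image. *)
Lemma prod_rtransE (B : {set G}) h x : subgroup_of op B [set: G] -> h \in B ->
  prod_set op B (rtrans op B x) = rtrans op B (h * x).
Proof.
move=> sB hB; apply/esym/eqP; rewrite eqEcard distL // card_rtrans leqnn andbT.
have clB : {in B &, forall a b, a * b \in B} by case: sB => _ [].
apply/subsetP=> _ /imsetP[b bB ->]; rewrite opDl.
by apply: imset2_f; [apply: clB | apply: imset_f].
Qed.

Lemma rtrans_prodE (B : {set G}) p k : subgroup_of op B [set: G] -> k \in B ->
  prod_set op (rtrans op B p) B = rtrans op B (p * k).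
Proof.
move=> sB kB; apply/esym/eqP; rewrite eqEcard distR // card_rtrans leqnn andbT.
have clB : {in B &, forall a b, a * b \in B} by case: sB => _ [].
apply/subsetP=> _ /imsetP[b bB ->]; rewrite opDl.
by apply: imset2_f; [apply: imset_f | apply: clB].
Qed.

(** Both generated subgroups have a translate by the same element [p * x] that
    contains the product, and translates by a common element intersect in the
    translate of the intersection. *)
Lemma prod_in_meet p x a b : a \in A -> b \in A ->
  (a * p) * (b * x) \in
    rtrans op (generated A p :&: generated A x) (p * x).
Proof.
move=> aA bA.
have memg q c : c \in A -> c \in generated A q by apply/subsetP/sub_generated.
have mulg q := op_closedP _ (generated_closed A q).
have /imsetP[h hH Eh] : (a * p) * (b * x) \in rtrans op (generated A p) (p * x).
  rewrite -(prod_rtransE _ (generated_subgroup p) (generated_id A p)).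
  apply: imset2_f; last exact/imset_f/memg.
  by apply: mulg; [exact: memg | exact: generated_id].
have : (a * p) * (b * x) \in rtrans op (generated A x) (p * x).
  rewrite -(rtrans_prodE _ (generated_subgroup x) (generated_id A x)).
  apply: imset2_f; first exact/imset_f/memg.
  by apply: mulg; [exact: memg | exact: generated_id].
by rewrite Eh !mem_rtrans inE hH.
Qed.

(** The set [(A * p) * t] is a copy of the simple group [A].  If it met some
    [(A * m) * y] twice, it would be contained in it; as it also meets [A * y],
    this forces [m] to be in [A], hence [(A * p) * t] to be inside [A * y]. *)
Lemma many_translates (M : {set G}) (p t y : G) :
  op_closed M -> A \subset M ->
  (forall a, a \in A -> (a * p) * t \in rtrans op M y) ->
  (exists2 b, b \in A & (b * p) * t \in rtrans op A y) ->
  (exists2 a, a \in A & (a * p) * t \notin rtrans op A y) ->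
  #|A| <= #|[set rtrans op A m | m in M]|.
Proof.
move=> clM AM inM [b bA bt] [a aA /negP at_].
have AM' c : c \in A -> c \in M by apply/subsetP.
have meet c : c \in A -> exists2 m, m \in M & (c * p) * t = (b * m) * y.
  move=> cA; have /imsetP[n nM ->] := inM c cA.
  have [m mM <-] := closed_ldiv clM (AM' b bA) nM.
  by exists m.
(* [f c] is a translate A.m whose image under [op^~ y] contains [(c * p) * t];
   the default value is never used on [A]. *)
pose f c := odflt (rtrans op A b) [pick S in [set rtrans op A m | m in M] |
   (c * p) * t \in rtrans op S y].
have fP c : c \in A -> f c \in [set rtrans op A m | m in M] /\
    (c * p) * t \in rtrans op (f c) y.
  move=> cA; rewrite /f; case: pickP => [S /andP[] // | nS].
  have [m mM E] := meet c cA; have := nS (rtrans op A m).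
  by rewrite imset_f // E mem_rtrans mem_rtrans bA.
suff f_inj : {in A &, injective f}.
  have <- : #|f @: A| = #|A| by apply: card_in_imset.
  apply/subset_leq_card/subsetP.
  by move=> _ /imsetP[c /fP[fc _] ->].
move=> c c' cA c'A Ef; apply/eqP; apply: contraT => ncc'; case: at_.
have [/imsetP[m mM Em] cS] := fP c cA; have [_ c'S] := fP c' c'A.
rewrite -Ef Em in c'S; rewrite Em in cS.
have clS := rtrans_closed y (rtrans_closed m clA).
set S := rtrans op A m in clS cS c'S.
have clE : op_closed [set d | (d * p) * t \in rtrans op S y].
  apply/op_closedP=> d d'; rewrite !inE => dE d'E.
  by rewrite (opDr d d' p) (opDr (d * p)) (op_closedP _ clS).
have /subsetP AS : A \subset [set d | (d * p) * t \in rtrans op S y].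
  by apply: simple_sub_closed clE _ _ ncc'; rewrite !inE ?cA ?c'A.
have mA : m \in A.
  have := AS b bA; rewrite inE; case/imsetP: bt => a1 a1A ->.
  rewrite mem_rtrans => /imsetP[a2 a2A Ea]; rewrite Ea in a1A.
  exact: closed_ldiv_mem a1A.
have := AS a aA; rewrite inE => /imsetP[_ /imsetP[d dA ->] ->].
by rewrite mem_rtrans (op_closedP _ clA).
Qed.

(** * The special sets *)

Lemma special_dichotomy :
  (forall p, special op A p) \/ #|A| <= #|special_sets op A|.
Proof.
have [/forallP | /forallPn[p0 np0]] := boolP [forall p, special op A p].
  by left.
right.
(* Minimality of the generated subgroup is what makes all of [M] special. *)
have [p np pmin] := @arg_minnP _ p0 (fun p => ~~ special op A p)
  (fun p => #|generated A p|) np0.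
have [x [a [b [aA bA out]]]] := special_witness np.
set M := generated A p :&: generated A x.
have clM : op_closed M.
  apply/op_closedP=> c d /setIP[c1 c2] /setIP[d1 d2].
  by rewrite inE !(op_closedP _ (generated_closed A _)).
have AM : A \subset M by rewrite subsetI !sub_generated.
(* If [M] were all of [generated A p], then [p] would be in [generated A x]
   and mediality would contradict the choice of [x], [a] and [b]. *)
have properM : M \proper generated A p.
  rewrite properEneq subsetIl andbT; apply: contraNneq out => EM.
  have px : p \in generated A x.
    by have := generated_id A p; rewrite -EM => /setIP[].
  by rewrite medial_of_generated // mem_rtrans (op_closedP _ clA).
have specM m : m \in M -> special op A m.
  move=> mM; apply: contraT => /pmin; rewrite leqNgt => /negP[].
  apply: leq_ltn_trans (proper_card properM).
  exact: subset_leq_card (generated_min clM AM mM).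
apply: (@leq_trans #|[set rtrans op A m | m in M]|).
  apply: (many_translates (p := p) (t := b * x) (y := p * x)) => //.
  - by move=> c cA; apply: prod_in_meet.
  (* (b.p).(b.x) = b.(p.x) lies in A.(p.x). *)
  - by exists b => //; rewrite -opDl mem_rtrans.
  - by exists a.
apply/subset_leq_card/subsetP=> _ /imsetP[m /specM sm ->].
exact: imset_f.
Qed.

End SimpleSubgroup.
End DistributiveQuasigroup.

Theorem theorem5p13 (G : finType) (op : G -> G -> G) (A : {set G}) (v : nat) :
  distinguished op ->
  subgroup_of op A [set: G] ->
  simple_group op A ->
  #|A| = v ->
  (special_union op A = [set: G] /\
   (forall p : G, rtrans op A p \in special_sets op A)) \/
  (exists F : {set {set G}},
     [/\ (v <= #|F|)%N,
         F \subset special_sets op A &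
         {in F, forall S : {set G}, subgroup_of op S [set: G]}]).
Proof.
move=> [[_ _ lsol rsol dist] distg] [_ [A0 /op_closedP clA _ _ _]] [_ simA] <-.
have opI a : injective (op a).
  move=> x y E; have [z [_ uz]] := lsol a (op a x) (in_setT _) (in_setT _).
  by rewrite -(uz x) ?(uz y) // E.
have opIr c : injective (op^~ c).
  move=> x y E; have [z [_ uz]] := rsol c (op x c) (in_setT _) (in_setT _).
  by rewrite -(uz x) ?(uz y) // /= E.
have opDr a b c : op (op a b) c = op (op a c) (op b c).
  by have [] := dist a b c (in_setT _) (in_setT _) (in_setT _).
have opDl a b c : op c (op a b) = op (op c a) (op c b).
  by have [] := dist a b c (in_setT _) (in_setT _) (in_setT _).
have simpleA (E : {set G}) : op_closed op E -> E \subset A -> 1 < #|E| -> E = A.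
  move=> clE EA E1; apply/eqP; apply: contraT => nEA; case: simA.
  have E0 : E != set0 by rewrite -card_gt0 ltnW.
  exists E; split=> //; last by rewrite properEneq nEA.
  by split=> //; have [] := closed_subgroup opI opIr opDr opDl E0 clE.
have distL (B : {set G}) p : subgroup_of op B [set: G] ->
  #|prod_set op B (rtrans op B p)| = #|B| by case/(distg B p).
have distR (B : {set G}) p : subgroup_of op B [set: G] ->
  #|prod_set op (rtrans op B p) B| = #|B| by case/(distg B p).
have [spec | many] :=
  special_dichotomy opI opIr opDr opDl clA simpleA distL distR; [left | right].
  have specS p : rtrans op A p \in special_sets op A by apply: imset_f (spec p).
  split=> //; apply/setP=> y; rewrite inE; apply/bigcupP.
  have /set0Pn[a aA] := A0.
  have clT : op_closed op [set: G] by apply/op_closedP=> b c; rewrite !inE.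
  have [p _ <-] := closed_ldiv opI clT (in_setT a) (in_setT y).
  by exists (rtrans op A p); [apply: specS | apply: imset_f].
exists (special_sets op A); split=> // _ /imsetP[l _ ->].
apply: (closed_subgroup opI opIr opDr opDl); last exact: rtrans_closed.
by rewrite -card_gt0 card_rtrans // card_gt0.
Qed.
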